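(* Let $n\geq 3$ and let $F\subseteq V(Q_n^3)$ be a vertex cut of $Q_n^3$ (i.e. $Q_n^3-F$ is disconnected) with $|F|\leq 8n-13$. Then $Q_n^3-F$ satisfies one of the following: (1) it has exactly two components, one of which is a single vertex, or a single edge ($K_2$), or a path on three vertices, or a cycle of length $3$; (2) it has exactly three components, two of which are single vertices; (3) it has exactly three components, two of which are a single vertex and a single edge ($K_2$), respectively; (4) it has exactly four components, three of which are single vertices.
   Context: The $3$-ary $n$-cube $Q_n^3$ is the graph whose vertices are the strings $u=u_{n-1}u_{n-2}\cdots u_0$ with $u_i\in\{0,1,2\}$, two vertices $u,v$ being adjacent if and only if there is an index $j$ with $u_j=v_j\pm 1 \pmod 3$ and $u_i=v_i$ for all $i\neq j$. *)

(* Defs.v *)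
From mathcomp Require Import all_boot all_order all_algebra.

Set Implicit Arguments.
Unset Strict Implicit.
Unset Printing Implicit Defensive.

(* A finite simple graph is a symmetric irreflexive relation on a finType. *)

Section Graphs.
Variables (T : finType) (e : rel T).
Implicit Types S C : {set T}.

Definition induced S : rel T := [rel x y | [&& x \in S, y \in S & e x y]].

Definition connected_on S : Prop := {in S &, forall x y, connect (induced S) x y}.

Definition components S : {set {set T}} :=
  equivalence_partition (connect (induced S)) S.

Definition vertex_cut (F : {set T}) : Prop := ~ connected_on (~: F).

Definition induces_copy (T' : finType) (e' : rel T') C : Prop :=
  exists f : T' -> T,
    [/\ injective f, f @: [set: T'] = C & forall i j, e (f i) (f j) = e' i j].

End Graphs.

Definition complete_graph k : rel 'I_k := [rel i j | i != j].

Definition path_graph k : rel 'I_k :=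
  [rel i j : 'I_k | (i.+1 == j :> nat) || (j.+1 == i :> nat)].

(* A simple graph only for [k >= 3]. *)
Definition cycle_graph k : rel 'I_k :=
  [rel i j : 'I_k | (i.+1 == j %[mod k]) || (j.+1 == i %[mod k])].

Definition ternary_string n := {ffun 'I_n -> 'Z_3}.

Definition ternary_cube n : rel (ternary_string n) :=
  [rel u v : ternary_string n |
    [exists j, ((u j == v j + 1)%R || (u j == v j - 1)%R)
               && [forall i, (i != j) ==> (u i == v i)]]].

Lemma ternary_cube_sym n : symmetric (@ternary_cube n).
Proof.
suff sub (u v : ternary_string n) : ternary_cube u v -> ternary_cube v u.
  by move=> u v; apply/idP/idP; apply: sub.
move=> /existsP[j /andP[uvj /forallP uvN]]; apply/existsP; exists j.
apply/andP; split.
  by case/orP: uvj => /eqP ->; rewrite ?GRing.addrK ?GRing.subrK eqxx ?orbT.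
by apply/forallP => i; rewrite [v i == _]eq_sym.
Qed.

Lemma ternary_cube_irr n : irreflexive (@ternary_cube n).
Proof.
move=> u; apply/negbTE/negP => /existsP[j /andP[/orP[] /eqP uj _]]; move: uj;
  by case: (u j) => -[|[|[]]] // ? /(congr1 val).
Qed.

(* Main.v *)
(** Call disjoint vertex sets A, B with no edge between them separated, and let
    S be the complement of their union.  The heart of the matter is that in
    Q_n^3, |A|, |B| >= k with 1 <= k <= 4 forces |S| >= 2kn - c_k, where
    c = 0, 3, 7, 12.  This goes by induction on n.  The cube is three copies of
    Q_(n-1)^3, and A, B restrict to separated sets A_i, B_i of each copy;
    moreover A_i and B_j occupy disjoint positions even for i <> j, since
    vertices of different copies at the same position are adjacent, so
    |A_i| + |B_j| <= 3^(n-1).  These inequalities and the inductive bounds imply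
    the bound for n by arithmetic.

    Taking k = 4, a union of components of Q_n^3 - F with at least 4 vertices
    misses at most 3 vertices of Q_n^3 - F.  A smallest such union is a single
    component, so the other components have at most 3 vertices in total. *)
Require Import Defs.
From mathcomp Require Import all_boot all_order all_algebra.
From mathcomp Require Import zify.
Set Implicit Arguments.
Unset Strict Implicit.
Unset Printing Implicit Defensive.

(** * Adjacency in the cube and its three layers *)

Lemma Z3_adj (x y : 'Z_3) : ((x == y + 1)%R || (x == y - 1)%R) = (x != y).
Proof. by case: x y => [[|[|[|?]]] ?] [[|[|[|?]]] ?]. Qed.

(** As 1 and -1 are the only nonzero residues modulo 3, the cube is a Hamming graph. *)
Lemma ternary_cubeP n (u v : ternary_string n) :
  reflect (exists2 j, u j != v j & forall i, i != j -> u i = v i)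
          (ternary_cube u v).
Proof.
apply: (iffP existsP) => -[j].
  rewrite Z3_adj => /andP[uvj /forallP uvN]; exists j => // i ij.
  by apply/eqP; have:= uvN i; rewrite ij.
move=> uvj uvN; exists j; rewrite Z3_adj uvj; apply/forallP => i.
by apply/implyP => /uvN ->.
Qed.

Definition cons_string n (c : 'Z_3) (u : ternary_string n) :
    ternary_string n.+1 :=
  [ffun i => oapp u c (unlift ord0 i)].

Definition layer n (A : {set ternary_string n.+1}) (c : 'Z_3) :
    {set ternary_string n} :=
  cons_string c @^-1: A.

Lemma cons_string0 n c (u : ternary_string n) : cons_string c u ord0 = c.
Proof. by rewrite ffunE unlift_none. Qed.

Lemma cons_stringS n c (u : ternary_string n) i :
  cons_string c u (lift ord0 i) = u i.
Proof. by rewrite ffunE liftK. Qed.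

Lemma cons_string_inj n c : injective (@cons_string n c).
Proof.
move=> u v /ffunP uv; apply/ffunP => i.
by have := uv (lift ord0 i); rewrite !cons_stringS.
Qed.

Lemma ternary_cube_cons n c (u v : ternary_string n) :
  ternary_cube (cons_string c u) (cons_string c v) = ternary_cube u v.
Proof.
apply/ternary_cubeP/ternary_cubeP => -[j uvj uvN].
  case: (unliftP ord0 j) => [k jE|jE]; last first.
    by rewrite jE !cons_string0 eqxx in uvj.
  exists k => [|i ik]; first by rewrite jE !cons_stringS in uvj.
  have := uvN (lift ord0 i).
  by rewrite jE (inj_eq lift_inj) !cons_stringS; apply.
exists (lift ord0 j) => [|i]; first by rewrite !cons_stringS.
case: (unliftP ord0 i) => [k ->|->]; rewrite ?cons_string0 ?cons_stringS //.
by rewrite (inj_eq lift_inj) => /uvN.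
Qed.

Lemma ternary_cube_cons_head n c d (u : ternary_string n) :
  c != d -> ternary_cube (cons_string c u) (cons_string d u).
Proof.
move=> cd; apply/ternary_cubeP; exists ord0; first by rewrite !cons_string0.
by move=> i; case: (unliftP ord0 i) => [k ->|->] //; rewrite !cons_stringS.
Qed.

Lemma card_layers n (A : {set ternary_string n.+1}) :
  #|A| = \sum_c #|layer A c|.
Proof.
pose h (u : ternary_string n.+1) := u ord0.
rewrite -sum1_card (partition_big h predT) //=; apply: eq_bigr => c _.
rewrite sum1_card -(card_imset _ (@cons_string_inj n c)); apply: eq_card => u.
rewrite unfold_in; apply/andP/imsetP => [[uA /eqP uc]|[v]]; last first.
  by rewrite inE => vA ->; rewrite /h cons_string0.
have uE : u = cons_string c [ffun i => u (lift ord0 i)].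
  apply/ffunP => i; rewrite ffunE.
  by case: (unliftP ord0 i) => [k ->|->] //=; rewrite ffunE.
by exists [ffun i => u (lift ord0 i)]; rewrite // inE -uE.
Qed.

Lemma sum_Z3 (f : 'Z_3 -> nat) : \sum_c f c = f 0%R + f 1%R + f (2%:R)%R.
Proof.
rewrite !big_ord_recl big_ord0 addn0 addnA.
by congr (f _ + f _ + f _); apply: val_inj.
Qed.

Lemma card_ternary_string n : #|{: ternary_string n}| = 3 ^ n.
Proof. by rewrite card_ffun !card_ord. Qed.

(** * Separated sets and the lower bound on their complement *)

Definition separated (T : finType) (e : rel T) (A B : {set T}) :=
  {in A & B, forall x y, (x != y) && ~~ e x y}.

Lemma card_separated T e (A B : {set T}) :
  separated e A B -> #|A| + #|B| <= #|T|.
Proof.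
move=> sAB; have dAB : [disjoint A & B].
  rewrite disjoint_subset; apply/subsetP => x xA; apply/negP => xB.
  by have := sAB x x xA xB; rewrite eqxx.
by have := leq_card_setU A B; rewrite dAB => -[_ /eqP <-]; apply: max_card.
Qed.

Lemma separated_layer n (A B : {set ternary_string n.+1}) c :
  separated (@ternary_cube n.+1) A B ->
  separated (@ternary_cube n) (layer A c) (layer B c).
Proof.
move=> sAB u v; rewrite !inE => uA vB.
have := sAB _ _ uA vB.
by rewrite (inj_eq (@cons_string_inj n c)) ternary_cube_cons.
Qed.

Lemma card_layers_separated n (A B : {set ternary_string n.+1}) c d :
  separated (@ternary_cube n.+1) A B -> #|layer A c| + #|layer B d| <= 3 ^ n.
Proof.
move=> sAB; rewrite -card_ternary_string.
(* Separation by the empty relation is disjointness. *)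
apply: (@card_separated _ (fun _ _ => false)) => u v.
rewrite !inE andbT => uA vB.
apply/eqP => uv; have := sAB _ _ uA vB; rewrite uv.
have [->|cd] := eqVneq c d; first by rewrite eqxx.
by rewrite ternary_cube_cons_head // andbF.
Qed.

(* With [S] the complement of two separated sets of sizes [a] and [b] in a graph
   on [N] vertices, [sep_ineq] says [#|S| >= 2 * k * m - sep_defect k], without
   truncated subtraction.  Index 0 of the table is junk. *)
Definition sep_defect k := nth 0 [:: 0; 0; 3; 7; 12] k.

Definition sep_ineq m N a b :=
  forall k, 0 < k <= 4 -> k <= a -> k <= b ->
  a + b + 2 * k * m <= N + sep_defect k.

(** Taking [k] to be [minn a b], capped at 4, turns the quantified bound into a finite case split
    fit for linear arithmetic. *)
Lemma sep_ineqP m N a b : sep_ineq m N a b ->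
  [\/ a = 0, b = 0, minn a b = 1 /\ a + b + 2 * m <= N
    | [\/ minn a b = 2 /\ a + b + 4 * m <= N + 3,
          minn a b = 3 /\ a + b + 6 * m <= N + 7
        | 4 <= minn a b /\ a + b + 8 * m <= N + 12]].
Proof.
move=> H.
have [|a0] := posnP a; first by constructor 1.
have [|b0] := posnP b; first by constructor 2.
have := H 1 isT; have := H 2 isT; have := H 3 isT; have := H 4 isT.
rewrite /sep_defect /= => h4 h3 h2 h1.
case: (ltngtP (minn a b) 2) => ab2.
- by constructor 3; lia.
- case: (ltngtP (minn a b) 3) => ab3; constructor 4; first lia.
    by constructor 3; lia.
  by constructor 2; lia.
- by constructor 4; constructor 1; lia.
Qed.

Lemma expn3_cases m :
  [\/ m = 0 /\ 3 ^ m = 1, m = 1 /\ 3 ^ m = 3, m = 2 /\ 3 ^ m = 9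
    | 3 <= m /\ 18 * m <= 3 ^ m + 27].
Proof.
case: m => [|[|[|m]]];
  [constructor 1 | constructor 2 | constructor 3 | constructor 4] => //.
split=> //; elim: m => // m; rewrite (expnS _ m.+3); lia.
Qed.

(** Here [N] stands for 3^m and the [ai], [bi] for layer sizes. For instance, if only [b0] is
    nonzero and [k <= a0], adding the bound for layer 0 to [a1 + b0 <= N] and [a2 + b0 <= N] leaves
    a gain of [2 * b0], which is at least the required 2k. *)
Lemma sep_ineq_step m N a0 a1 a2 b0 b1 b2 :
  [\/ m = 0 /\ N = 1, m = 1 /\ N = 3, m = 2 /\ N = 9
    | 3 <= m /\ 18 * m <= N + 27] ->
  sep_ineq m N a0 b0 -> sep_ineq m N a1 b1 -> sep_ineq m N a2 b2 ->
  a0 + b0 <= N -> a0 + b1 <= N -> a0 + b2 <= N ->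
  a1 + b0 <= N -> a1 + b1 <= N -> a1 + b2 <= N ->
  a2 + b0 <= N -> a2 + b1 <= N -> a2 + b2 <= N ->
  sep_ineq m.+1 (3 * N) (a0 + a1 + a2) (b0 + b1 + b2).
Proof.
move=> Hm /sep_ineqP H0 /sep_ineqP H1 /sep_ineqP H2.
move=> h00 h01 h02 h10 h11 h12 h20 h21 h22 k hk ha hb.
have : k = 1 \/ k = 2 \/ k = 3 \/ k = 4 by lia.
case: Hm => -[E1 E2]; clear hk.
all: case => [?|[?|[?|?]]]; subst k; rewrite /sep_defect /=.
(* The third layer is split only where the first two do not settle the case. *)
all: case: H0 => [H0|H0|H0|[]H0]; case: H1 => [H1|H1|H1|[]H1];
  try (clear H2; lia); case: H2 => [H2|H2|H2|[]H2]; lia.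
Qed.

Lemma separated_ineq n (A B : {set ternary_string n}) :
  separated (@ternary_cube n) A B -> sep_ineq n (3 ^ n) #|A| #|B|.
Proof.
elim: n A B => [|n IHn] A B sAB.
  (* On a single vertex one of the two sets is empty, so no [k] qualifies. *)
  move: (card_separated sAB); rewrite card_ternary_string expn0 => h k.
  by move: #|A| #|B| h => a b; lia.
rewrite expnS !card_layers !sum_Z3.
apply: sep_ineq_step; first exact: expn3_cases;
  by [apply: IHn; apply: separated_layer | apply: card_layers_separated].
Qed.

(** * Components of an induced subgraph *)

Section Components.
Variables (T : finType) (e : rel T).
Hypotheses (e_sym : symmetric e) (e_irr : irreflexive e).
Implicit Types W U C : {set T}.

Lemma connect_induced_sym W : connect_sym (induced e W).
Proof. by apply: sym_connect_sym => x y; rewrite /induced /= e_sym andbCA. Qed.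

Lemma components_partition W : partition (components e W) W.
Proof.
apply: equivalence_partitionP => x y z _ _ _; split; first exact: connect0.
by move=> xy; apply: (same_connect (connect_induced_sym W) xy).
Qed.

Lemma components_connect W C x y :
  C \in components e W -> x \in C -> y \in W ->
  (y \in C) = connect (induced e W) x y.
Proof.
case/imsetP => z zW -> /[!inE] /andP[xW zx] yW; rewrite yW /=.
by apply: (same_connect (connect_induced_sym W) zx).
Qed.

Lemma components_closed W C x y :
  C \in components e W -> x \in C -> y \in W -> e x y -> y \in C.
Proof.
move=> CW xC yW exy; rewrite (components_connect CW xC yW).
apply: connect1; rewrite /induced /= yW exy !andbT.
by apply: (subsetP (partitionS (components_partition W) CW)).
Qed.

(** A walk from [x] to another vertex of [C] has a first edge, whose far end stays in [C]. *)
Lemma component_neighbour W C x :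
  C \in components e W -> x \in C -> 1 < #|C| -> exists2 y, y \in C & e x y.
Proof.
move=> CW xC; rewrite (cardsD1 x) xC ltnS card_gt0 => /set0Pn[y /setD1P[yx yC]].
have sCW := subsetP (partitionS (components_partition W) CW).
have := components_connect CW xC (sCW _ yC).
rewrite yC => /esym/connectP[[|z p] /=].
  by move=> _ yE; rewrite yE eqxx in yx.
case/andP => /and3P[xW zW exz] _ _; exists z => //.
exact: components_closed CW xC zW exz.
Qed.

(** * Components with at most three vertices *)

Lemma singleton_copy C : #|C| = 1 -> induces_copy e (@complete_graph 1) C.
Proof.
move/eqP/cards1P => [x ->]; exists (fun => x); split.
- by move=> i j _; rewrite !ord1.
- by apply/setP => y; rewrite inE; apply/imsetP/eqP => [[]|->] //; exists ord0.
- by move=> i j; rewrite e_irr !ord1.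
Qed.

Lemma component2_copy W C :
  C \in components e W -> #|C| = 2 -> induces_copy e (@complete_graph 2) C.
Proof.
move=> CW C2; have /eqP/cards2P[x [y [xy CE]]] := C2.
have exy : e x y.
  have [||z] := @component_neighbour W C x CW; rewrite ?C2 // CE ?set21 //.
  by case/set2P => ->; rewrite ?e_irr.
exists (fun i : 'I_2 => if i == ord0 then x else y); split.
- move=> i j; case: eqVneq => [->|i0]; case: eqVneq => [->|j0] // E.
  + by rewrite E eqxx in xy.
  + by rewrite E eqxx in xy.
  + by case: i j i0 j0 {E} => [[|[|?]] ?] [[|[|?]] ?] // _ _; apply: val_inj.
- apply/setP => z; rewrite CE; apply/imsetP/set2P => [[i _ ->]|].
    by case: eqP; [left|right].
  by case=> ->; [exists ord0 | exists ord_max].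
- by case=> [[|[|?]] ?] [[|[|?]] ?]; rewrite //= ?e_irr // e_sym.
Qed.

Lemma cards3P C : #|C| = 3 ->
  exists x y z, [/\ C = [set x; y; z], x != y, x != z & y != z].
Proof.
move=> C3; have /set0Pn[x xC] : C != set0 by rewrite -card_gt0 C3.
have : #|C :\ x| == 2 by have := cardsD1 x C; rewrite xC C3; lia.
case/cards2P => y [z [yz CE]]; exists x, y, z.
have : (y \in C :\ x) && (z \in C :\ x) by rewrite CE set21 set22.
rewrite !inE => /andP[/andP[yx _] /andP[zx _]].
by split; rewrite 1?[x == _]eq_sym // -(setD1K xC) CE setUA.
Qed.

(** With [nth], injectivity reduces to [nth_uniq]; the default [x] is never reached, as [i < 3]. *)
Definition triple (x y z : T) (i : 'I_3) := nth x [:: x; y; z] i.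

Lemma triple_inj x y z : x != y -> x != z -> y != z -> injective (triple x y z).
Proof.
move=> xy xz yz i j /eqP; rewrite /triple nth_uniq ?ltn_ord //=.
  by move/eqP/val_inj.
by rewrite !inE negb_or xy xz yz.
Qed.

Lemma triple_image x y z : triple x y z @: [set: 'I_3] = [set x; y; z].
Proof.
apply/setP => t; apply/imsetP/idP => [[[[|[|[|?]]] ?] _ ->]|] //;
  rewrite ?inE ?eqxx ?orbT //.
by case/orP => [/orP[]|] /eqP ->;
  [exists (inord 0) | exists (inord 1) | exists (inord 2)];
  rewrite // /triple inordK.
Qed.

Lemma path3_copy x y z : e x y -> e y z -> x != z -> ~~ e x z ->
  induces_copy e (@path_graph 3) [set x; y; z].
Proof.
move=> xy yz xz nxz; exists (triple x y z); split; last 1 first.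
- by case=> [[|[|[|?]]] ?] [[|[|[|?]]] ?];
    rewrite // /triple /= ?e_irr // ?xy ?yz ?(negPf nxz)
    // e_sym ?xy ?yz // (negPf nxz).
- by apply: triple_inj => //;
    [apply: contraTneq xy | apply: contraTneq yz] => ->; rewrite e_irr.
- exact: triple_image.
Qed.

Lemma cycle3_copy x y z : e x y -> e y z -> e x z ->
  induces_copy e (@cycle_graph 3) [set x; y; z].
Proof.
move=> xy yz xz; exists (triple x y z); split; last 1 first.
- by case=> [[|[|[|?]]] ?] [[|[|[|?]]] ?];
    rewrite // /triple /= ?e_irr // ?xy ?yz ?xz // e_sym ?xy ?yz ?xz.
- by apply: triple_inj;
    [apply: contraTneq xy | apply: contraTneq xz | apply: contraTneq yz] => ->;
    rewrite e_irr.
- exact: triple_image.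
Qed.

(** Three edges make a cycle and two make a path; with at most one edge some vertex has no neighbour
    in [C], against [component_neighbour]. *)
Lemma component3_copy W C : C \in components e W -> #|C| = 3 ->
  induces_copy e (@path_graph 3) C \/ induces_copy e (@cycle_graph 3) C.
Proof.
move=> CW C3; have [x [y [z [CE xy xz yz]]]] := cards3P C3.
have nb t : t \in C -> exists2 u, u \in C & e t u.
  by move=> tC; apply: component_neighbour CW tC _; rewrite C3.
(* Reorderings that put [x], respectively [z], in the middle of the path. *)
have CE1 : C = [set y; x; z] by rewrite CE [[set x; y]]setUC.
have CE2 : C = [set x; z; y] by rewrite CE setUAC.
have [exy|nxy] := boolP (e x y); have [eyz|nyz] := boolP (e y z);
  have [exz|nxz] := boolP (e x z).
- by right; rewrite CE; apply: cycle3_copy.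
- by left; rewrite CE; apply: path3_copy.
- by left; rewrite CE1; apply: path3_copy => //; rewrite e_sym.
- have [|u] := nb z; first by rewrite CE !inE eqxx !orbT.
  by rewrite CE !inE -orbA => /or3P[] /eqP ->;
    rewrite ?e_irr // e_sym ?(negPf nxz) ?(negPf nyz).
- by left; rewrite CE2; apply: path3_copy => //; rewrite e_sym.
- have [|u] := nb x; first by rewrite CE !inE eqxx.
  by rewrite CE !inE -orbA => /or3P[] /eqP ->;
    rewrite ?e_irr // ?(negPf nxz) ?(negPf nxy).
- have [|u] := nb y; first by rewrite CE !inE eqxx !orbT.
  by rewrite CE !inE -orbA => /or3P[] /eqP ->;
    rewrite ?e_irr // e_sym ?(negPf nxy) // e_sym (negPf nyz).
- have [|u] := nb x; first by rewrite CE !inE eqxx.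
  by rewrite CE !inE -orbA => /or3P[] /eqP ->;
    rewrite ?e_irr // ?(negPf nxz) ?(negPf nxy).
Qed.

(** * Unions of components, and a component missing few vertices *)

(** These are the unions of components of the graph induced on [W], described edge by edge. *)
Definition closed_in W U :=
  (U \subset W) && [forall x in U, forall y in W, e x y ==> (y \in U)].

Lemma closed_inP W U :
  reflect (U \subset W /\ {in U & W, forall x y, e x y -> y \in U})
          (closed_in W U).
Proof.
apply: (iffP andP) => -[UW cU]; split=> //.
  by move=> x y xU yW; have /forall_inP/(_ y yW)/implyP := forall_inP cU x xU.
by apply/forall_inP => x xU; apply/forall_inP => y yW; apply/implyP; apply: cU.
Qed.

(** By symmetry, an edge from [U :\: C] into [C] would also leave the closed set [C]. *)
Lemma closed_inD W U C :
  closed_in W U -> closed_in W C -> closed_in W (U :\: C).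
Proof.
move=> /closed_inP[UW cU] /closed_inP[CW cC]; apply/closed_inP; split.
  exact: subset_trans (subsetDl _ _) UW.
move=> x y /setDP[xU xC] yW exy; rewrite inE (cU x) // andbT.
apply: contra xC => yC; apply: (cC y) => //; last by rewrite e_sym.
exact: (subsetP UW).
Qed.

Lemma component_closed_in W C : C \in components e W -> closed_in W C.
Proof.
move=> CW; apply/closed_inP; split.
  exact: partitionS (components_partition W) CW.
by move=> x y; apply: components_closed.
Qed.

Lemma component_sub_closed W U C x :
  closed_in W U -> C \in components e W -> x \in C -> x \in U -> C \subset U.
Proof.
move=> /closed_inP[UW cU] CW xC xU; apply/subsetP => y yC.
have yW := subsetP (partitionS (components_partition W) CW) _ yC.
have := components_connect CW xC yW.
rewrite yC => /esym/connectP[p pP ->] {y yC yW}.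
elim: p x xU pP {xC} => //= y p IHp x xU /andP[/and3P[xW yW exy]]; apply: IHp.
exact: cU exy.
Qed.

Lemma closed_in_separated W U : closed_in W U -> separated e U (W :\: U).
Proof.
move=> /closed_inP[UW cU] x y xU /setDP[yW yU].
apply/andP; split; first by apply: contraNneq yU => <-.
by apply: contra yU; apply: cU.
Qed.

(* A smallest closed set with more than [k] elements is a component: otherwise
   it splits into two closed sets of at most [k] elements each. *)
Lemma large_component k W :
  3 * k < #|W| ->
  (forall U, closed_in W U -> k < #|U| -> #|W :\: U| <= k) ->
  exists2 C, C \in components e W & #|W :\: C| <= k.
Proof.
move=> kW small.
pose P U := closed_in W U && (k < #|U|).
have WP : P W.
  by apply/andP; split; [apply/closed_inP; split|lia].
have [U /andP[cU kU] Umin] := @arg_minnP _ W P (fun U => #|U|) WP.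
have /closed_inP[UW _] := cU.
have /set0Pn[x xU] : U != set0 by rewrite -card_gt0; lia.
have pW := components_partition W.
have xW : x \in cover (components e W).
  by rewrite (cover_partition pW) (subsetP UW).
case/bigcupP: xW => C CW xC; exists C => //.
have CU := component_sub_closed cU CW xC xU.
have cC := component_closed_in CW.
have [kC|Ck] := ltnP k #|C|; first exact: small.
(* When [#|C| <= k], minimality of [U] gives [#|U :\: C| <= k]; with [#|W :\: U| <= k] this makes
   [#|W| <= 3 * k], a contradiction. *)
have DU := Umin (U :\: C); rewrite /P closed_inD //= in DU.
have := small U cU kU.
have := cardsD W U; have := cardsD U C; rewrite (setIidPr UW) (setIidPr CU).
have : 0 < #|C| by apply/card_gt0P; exists x.
have := subset_leq_card UW; have := subset_leq_card CU.
move: DU kW kU Ck.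
move: #|U :\: C| #|W :\: U| #|W :\: C| #|C| #|U| #|W|.
clear; lia.
Qed.

End Components.

(** * Classification of the remaining components *)

(** Blocks are nonempty, so the cases are the integer partitions of 1, 2 and 3. *)
Lemma partition_le3 (T : finType) (P : {set {set T}}) (D : {set T}) :
  partition P D -> 0 < #|D| <= 3 ->
  [\/ exists2 A, P = [set A] & [\/ #|A| = 1, #|A| = 2 | #|A| = 3],
      exists A B, [/\ P = [set A; B], A != B, #|A| = 1 & #|B| = 1 \/ #|B| = 2]
    | exists A B C, [/\ P = [set A; B; C], [/\ A != B, A != C & B != C],
                        #|A| = 1, #|B| = 1 & #|C| = 1]].
Proof.
move=> pP; have A0 A : A \in P -> 0 < #|A|.
  by move=> AP; rewrite card_gt0 (partition_neq0 pP).
have PD : #|P| <= #|D|.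
  by rewrite (card_partition pP) -sum1_card; apply: leq_sum.
rewrite (card_partition pP) in PD *; case P3: #|P| => [|[|[|[|k]]]] in PD *.
- by move/eqP: P3; rewrite cards_eq0 => /eqP ->; rewrite big_set0.
- have /eqP/cards1P[A PE] := P3; rewrite PE big_set1 => A3.
  by constructor 1; exists A => //; case: #|A| A3 => [|[|[|[|]]]] // _;
    [constructor 1 | constructor 2 | constructor 3].
- have /eqP/cards2P[A [B [AB PE]]] := P3.
  have [A1 B1] : 0 < #|A| /\ 0 < #|B|.
    by split; apply: A0; rewrite PE ?set21 ?set22.
  rewrite PE big_setU1 ?inE //= big_set1 => ABle.
  have [A2|A2] := leqP #|A| 1.
    by constructor 2; exists A, B; split=> //; lia.
  by constructor 2; exists B, A; split; rewrite 1?eq_sym // 1?setUC //; lia.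
- have [A [B [C [PE AB AC BC]]]] := cards3P P3.
  have : [/\ 0 < #|A|, 0 < #|B| & 0 < #|C|].
    by split; apply: A0; rewrite PE !inE eqxx ?orbT.
  case=> A1 B1 C1.
  rewrite PE -setUA !big_setU1 ?inE ?negb_or ?AB //= big_set1 => le3.
  by constructor 3; exists A, B, C; split; rewrite ?setUA //; lia.
- by case/andP=> _; move/(leq_trans PD).
Qed.

Lemma ternary_cube_large_component n (F : {set ternary_string n}) :
  3 <= n -> #|F| <= 8 * n - 13 ->
  exists2 C, C \in components (@ternary_cube n) (~: F) & #|~: F :\: C| <= 3.
Proof.
move=> n3 Fle; have FW := cardsC F; rewrite card_ternary_string in FW.
apply: large_component; first exact: ternary_cube_sym.
  (* At least (18n - 27) - (8n - 13) = 10n - 14 >= 16 vertices survive, more than 3 * 3. *)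
  move: (3 ^ n) (expn3_cases n) #|F| #|~: F| Fle FW => N HN f w.
  by case: HN => -[]; lia.
move=> U cU U4; rewrite leqNgt; apply/negP => D4.
(* Two sides of size at least 4 would force [#|F|] to be at least 8n - 12. *)
have := separated_ineq (closed_in_separated cU) (k := 4) isT U4 D4.
have /closed_inP[UW _] := cU; have := cardsD (~: F) U; rewrite (setIidPr UW).
have := subset_leq_card UW; rewrite /sep_defect /=.
move: U4 D4 Fle FW; move: (3 ^ n) #|F| #|~: F| #|U| #|~: F :\: U|.
lia.
Qed.

Theorem theorem3p7 (n : nat) (F : {set ternary_string n}) :
  3 <= n ->
  vertex_cut (@ternary_cube n) F ->
  #|F| <= 8 * n - 13 ->
  let comps := components (@ternary_cube n) (~: F) in
  let is_copy_of k (G : rel 'I_k) C := induces_copy (@ternary_cube n) G C in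
  let K1 := is_copy_of 1 (@complete_graph 1) in
  let K2 := is_copy_of 2 (@complete_graph 2) in
  let P3 := is_copy_of 3 (@path_graph 3) in
  let C3 := is_copy_of 3 (@cycle_graph 3) in
  [\/ #|comps| = 2 /\
        exists2 C, C \in comps & [\/ K1 C, K2 C, P3 C | C3 C],
      #|comps| = 3 /\
        exists A B, [/\ A \in comps, B \in comps, A != B, K1 A & K1 B],
      #|comps| = 3 /\
        exists A B, [/\ A \in comps, B \in comps, A != B, K1 A & K2 B]
    | #|comps| = 4 /\
        exists A B C,
          [/\ [/\ A \in comps, B \in comps & C \in comps],
              [/\ A != B, A != C & B != C] & [/\ K1 A, K1 B & K1 C]]].
Proof.
move=> n3 cutF Fle comps is_copy_of K1 K2 P3 C3.
have [C CW Cle] := ternary_cube_large_component n3 Fle.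
have e_sym := @ternary_cube_sym n; have e_irr := @ternary_cube_irr n.
have pW : partition comps (~: F) := components_partition e_sym _.
have pD := partitionD1 pW CW.
(* If [C] were the whole complement of [F], that complement would be connected. *)
have D0 : 0 < #|~: F :\: C|.
  rewrite card_gt0; apply: contra_notN cutF; rewrite setD_eq0 => WC.
  by move=> x y xW yW; rewrite -(components_connect e_sym CW) // (subsetP WC).
have D3 : 0 < #|~: F :\: C| <= 3 by rewrite D0.
have cE : #|comps| = #|comps :\ C|.+1 by rewrite (cardsD1 C) CW.
have inP A : A \in comps :\ C -> A \in comps by case/setD1P.
have copy1 := singleton_copy e_irr.
have copy2 A (AW : A \in comps) := component2_copy e_sym e_irr AW.
have copy3 A (AW : A \in comps) := component3_copy e_sym e_irr AW.
(* One block gives conclusion (1), two give (2) or (3), three give (4); [C] is the one further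
   component. *)
have [[A PE cA]|[A [B [PE AB A1 B12]]]|[A [B [D [PE [AB AD BD] A1 B1 D1]]]]] :=
  partition_le3 pD D3; rewrite PE in inP cE.
- have AW : A \in comps by apply: inP; rewrite set11.
  constructor 1; split; first by rewrite cE cards1.
  exists A => //; case: cA => cA; first by constructor 1; apply: copy1.
    by constructor 2; apply: copy2.
  by case: (copy3 A AW cA); [constructor 3|constructor 4].
- have [AW BW] : A \in comps /\ B \in comps.
    by split; apply: inP; rewrite ?set21 ?set22.
  have c3 : #|comps| = 3 by rewrite cE cards2 AB.
  case: B12 => cB; [constructor 2|constructor 3]; split=> //;
    exists A, B; split=> //;
    by [apply: copy1 | apply: copy2].
- have [AW BW DW] : [/\ A \in comps, B \in comps & D \in comps].
    by split; apply: inP; rewrite !inE eqxx ?orbT.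
  constructor 4; split; last by exists A, B, D; split; split=> //; apply: copy1.
  by rewrite cE -setUA !cardsU1 cards1 !inE negb_or AB AD BD.
Qed.
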